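(* Let $(V,Y,\mathbf 1,\omega)$ be a vertex operator algebra and let $W$ be a vector space (not assumed graded) equipped with a linear map $Y_W(\cdot,x):V\to(\mathrm{End}\,W)[[x,x^{-1}]]$ satisfying the truncation condition and the Jacobi identity for modules. Then for all $u,v\in V$ and $w\in W$, $$\lim_{x_0\to -x_2+x_1}\Big((x_0+x_2)^{l(u,w)}\,Y_W(Y(u,x_0)v,x_2)w\Big)=x_1^{l(u,w)}\,Y_W(v,x_2)\,Y_W(u,x_1)w .$$
   Context: Vector spaces are over $\mathbb C$; $x,x_0,x_1,x_2$ are commuting formal variables; $\delta(x)=\sum_{n\in\mathbb Z}x^n$. Binomial expansion convention: a power of a binomial such as $(x_1-x_2)^n$ is expanded in nonnegative integral powers of the second variable. A vertex operator algebra $(V,Y,\mathbf 1,\omega)$ is a $\mathbb Z$-graded space $V=\coprod_n V_{(n)}$ with $V_{(n)}=0$ for $n$ sufficiently negative and $\dim V_{(n)}<\infty$, with a linear map $v\mapsto Y(v,x)=\sum_{n\in\mathbb Z}v_nx^{-n-1}\in(\mathrm{End}\,V)[[x,x^{-1}]]$ and vectors $\mathbf 1,\omega\in V$ such that: for $v,w\in V$, $v_nw=0$ for $n$ large; $Y(\mathbf 1,x)=1_V$; $Y(v,x)\mathbf 1\in V[[x]]$ with constant term $v$; writing $Y(\omega,x)=\sum_n L(n)x^{-n-2}$, $[L(m),L(n)]=(m-n)L(m+n)+c_V\frac{m^3-m}{12}\delta_{m+n,0}1_V$ for some $c_V\in\mathbb C$, $L(0)v=nv$ for $v\in V_{(n)}$,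 $Y(L(-1)u,x)=\frac{d}{dx}Y(u,x)$; and the Jacobi identity $x_0^{-1}\delta\big(\frac{x_1-x_2}{x_0}\big)Y(u,x_1)Y(v,x_2)-x_0^{-1}\delta\big(\frac{x_2-x_1}{-x_0}\big)Y(v,x_2)Y(u,x_1)=x_2^{-1}\delta\big(\frac{x_1-x_0}{x_2}\big)Y(Y(u,x_0)v,x_2)$. Write $Y_W(v,x)=\sum_{n\in\mathbb Z}v_n^Wx^{-n-1}$. Truncation condition: for $v\in V$, $w\in W$, $v_n^Ww=0$ for $n$ sufficiently large. Jacobi identity for modules: $x_0^{-1}\delta\big(\frac{x_1-x_2}{x_0}\big)Y_W(u,x_1)Y_W(v,x_2)-x_0^{-1}\delta\big(\frac{x_2-x_1}{-x_0}\big)Y_W(v,x_2)Y_W(u,x_1)=x_2^{-1}\delta\big(\frac{x_1-x_0}{x_2}\big)Y_W(Y(u,x_0)v,x_2)$ for $u,v\in V$. For $u\in V$, $w\in W$, $l(u,w)$ is the smallest nonnegative integer $l$ such that weak associativity $(x_0+x_2)^{l}Y_W(u,x_0+x_2)Y_W(v,x_2)w=(x_0+x_2)^{l}Y_W(Y(u,x_0)v,x_2)w$ holds for all $v\in V$. The formal limit $\lim_{x_0\to -x_2+x_1}f(x_0,x_2)$ means: replace each power $x_0^n$ in the (fully multiplied out) formal series $f$ by $(-x_2+x_1)^n$, expanded in nonnegative powers of $x_1$; that this is well defined is part of the assertion. *)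

(* Defs.v *)
From mathcomp Require Import all_boot all_order all_algebra.
From mathcomp Require Import boolp classical_sets functions cardinality fsbigop.
From mathcomp Require Import reals complex.

Set Implicit Arguments.
Unset Strict Implicit.
Unset Printing Implicit Defensive.

Import Order.TTheory GRing.Theory Num.Theory.
Local Open Scope classical_set_scope.
Local Open Scope ring_scope.

(* A formal series with coefficients in E is its coefficient function:
   int -> E in one variable, int * int -> E in two, int * int * int -> E in
   three, every exponent ranging over all of Z. *)

Section FormalCalculus.
Variable K : numFieldType.

(* n (n - 1) ... (n - i + 1) / i!, for n of any sign. *)
Definition binom_coef (n : int) (i : nat) : K :=
  (\prod_(j < i) (n%:~R - j%:R)) / i`!%:R.

(* Coefficient of y^p z^q in (a y + b z)^n, expanded in nonnegative powers of
   the second variable z: the sum over i >= 0 of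
   binom_coef n i * a^(n-i) * b^i * y^(n-i) * z^i. *)
Definition binom_exp (n : int) (a b : K) (p q : int) : K :=
  match q with
  | Posz i => if p + q == n then binom_coef n i * a ^ p * b ^+ i else 0
  | Negz _ => 0
  end.

(* Coefficient of t^r y^p z^q in
   delta ((a y + b z) / (c t)) = \sum_n (a y + b z)^n (c t)^(-n); only the
   summand n = - r contributes. *)
Definition delta_binom (a b c : K) (r p q : int) : K :=
  c ^ r * binom_exp (- r) a b p q.

(* Product of a scalar series by a vector series.  The sum is the finitely
   supported one: it is the intended product when every coefficient is a
   finite sum. *)
Definition series_mul (I : zmodType) (E : lmodType K)
    (a : I -> K) (f : I -> E) (e : I) : E :=
  \sum_(d \in [set: I]) (a d *: f (e - d)).

(* Substitution in the first of two variables: B n p q is the coefficient of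
   y^p x_2^q in the series that replaces the n-th power of the first variable.
   [subst_summable] says that every coefficient of the result is a finite
   sum. *)
Definition subst_term (E : lmodType K) (B : int -> int -> int -> K)
    (f : int * int -> E) (e d : int * int) : E :=
  B d.1 e.1 (e.2 - d.2) *: f d.

Definition subst_summable (E : lmodType K) (B : int -> int -> int -> K)
    (f : int * int -> E) : Prop :=
  forall e, finite_set [set d | subst_term B f e d != 0].

Definition subst_series (E : lmodType K) (B : int -> int -> int -> K)
    (f : int * int -> E) (e : int * int) : E :=
  \sum_(d \in [set: int * int]) subst_term B f e d.

(* x_1 |-> x_0 + x_2, result in the variables (x_0, x_2). *)
Definition plus_x0_x2 (n p q : int) : K := binom_exp n 1 1 p q.

(* x_0 |-> - x_2 + x_1, expanded in nonnegative powers of x_1; the result is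
   in the variables (x_1, x_2), so p is the exponent of x_1. *)
Definition minus_x2_plus_x1 (n p q : int) : K := binom_exp n (-1) 1 q p.

Definition has_formal_lim (E : lmodType K) (f g : int * int -> E) : Prop :=
  subst_summable minus_x2_plus_x1 f /\
  subst_series minus_x2_plus_x1 f = g.

End FormalCalculus.

Section VertexOperators.
Variable K : numFieldType.

(* YW v n w is the mode v_n w, where Y_W(v, x) = \sum_n v_n x^(-n-1). *)

Definition bilinear_modes (V W : lmodType K) (YW : V -> int -> W -> W) : Prop :=
  (forall v n, linear (YW v n)) /\
  (forall n w (a : K) v1 v2,
     YW (a *: v1 + v2) n w = a *: YW v1 n w + YW v2 n w).

Definition truncation (V W : lmodType K) (YW : V -> int -> W -> W) : Prop :=
  forall v w, exists N : int, forall n, N <= n -> YW v n w = 0.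

(* The series Y_W(v, x) w: the coefficient of x^p is the mode of index
   - p - 1. *)
Definition vop (V W : lmodType K) (YW : V -> int -> W -> W) v w (p : int) : W :=
  YW v (- p - 1) w.

(* Y_W(u, x_1) Y_W(v, x_2) w, in the variables (x_1, x_2). *)
Definition vop_prod (V W : lmodType K) (YW : V -> int -> W -> W) u v w
    (e : int * int) : W :=
  vop YW u (vop YW v w e.2) e.1.

(* Y_W(Y(u, x_0) v, x_2) w, in the variables (x_0, x_2). *)
Definition vop_iter (V W : lmodType K) (Y : V -> int -> V -> V)
    (YW : V -> int -> W -> W) u v w (e : int * int) : W :=
  vop YW (vop Y u v e.1) w e.2.

(* Both sides are series in (x_0, x_1, x_2).  The factors x_0^(-1) and
   x_2^(-1) shift the corresponding exponent in delta by one. *)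
Definition jacobi (V W : lmodType K) (Y : V -> int -> V -> V)
    (YW : V -> int -> W -> W) : Prop :=
  forall (u v : V) (w : W) (e : int * int * int),
    series_mul (fun '(i, j, k) => delta_binom 1 (-1) 1 (i + 1) j k)
               (fun '(i, j, k) => if i == 0 then vop_prod YW u v w (j, k) else 0)
               e
    - series_mul (fun '(i, j, k) => delta_binom 1 (-1) (-1) (i + 1) k j)
               (fun '(i, j, k) => if i == 0 then vop_prod YW v u w (k, j) else 0)
               e
    = series_mul (fun '(i, j, k) => delta_binom 1 (-1) 1 (k + 1) j i)
               (fun '(i, j, k) => if j == 0 then vop_iter Y YW u v w (i, k) else 0)
               e.

Record is_grading (V : lmodType K) (gr : int -> set V) : Prop := {
  gr_zero : forall n, gr n 0;
  gr_lin : forall n (a : K) v w, gr n v -> gr n w -> gr n (a *: v + w);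
  gr_direct_sum : forall v, exists! c : int -> V,
    [/\ forall n, gr n (c n),
        finite_set [set n | c n != 0] &
        v = \sum_(n \in [set: int]) c n];
  gr_lower_bounded : exists N : int, forall n, n < N -> gr n = [set 0];
  gr_finite_dim : forall n, exists (d : nat) (b : 'I_d -> V),
    forall v, gr n v <-> exists a : 'I_d -> K, v = \sum_i a i *: b i }.

(* L(n), where Y(om, x) = \sum_n L(n) x^(-n-2). *)
Definition vir (V : lmodType K) (Y : V -> int -> V -> V) (om : V) (n : int) :
  V -> V := Y om (n + 1).

Record is_voa (V : lmodType K) (gr : int -> set V) (Y : V -> int -> V -> V)
    (vac om : V) : Prop := {
  voa_grading : is_grading gr;
  voa_bilinear : bilinear_modes Y;
  voa_truncation : truncation Y;
  voa_vacuum : forall v p, vop Y vac v p = if p == 0 then v else 0;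
  voa_creation : forall v,
    (forall p, p < 0 -> vop Y v vac p = 0) /\ vop Y v vac 0 = v;
  voa_virasoro : exists c : K, forall (m n : int) v,
    vir Y om m (vir Y om n v) - vir Y om n (vir Y om m v)
    = (m - n)%:~R *: vir Y om (m + n) v
      + (if m + n == 0 then c * ((m ^+ 3 - m)%:~R / 12%:R) else 0) *: v;
  voa_L0 : forall n v, gr n v -> vir Y om 0 v = n%:~R *: v;
  voa_derivative : forall u v p,
    vop Y (vir Y om (-1) u) v p = (p + 1)%:~R *: vop Y u v (p + 1);
  voa_jacobi : jacobi Y Y }.

(* (x_0 + x_2)^l f(x_0, x_2). *)
Definition mul_pow_x0_x2 (E : lmodType K) (l : nat) (f : int * int -> E) :
    int * int -> E :=
  series_mul (fun d => binom_exp l 1 1 d.1 d.2) f.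

Definition weak_assoc_at (V W : lmodType K) (Y : V -> int -> V -> V)
    (YW : V -> int -> W -> W) (u : V) (w : W) (l : nat) : Prop :=
  forall v, mul_pow_x0_x2 l (subst_series (@plus_x0_x2 K) (vop_prod YW u v w))
          = mul_pow_x0_x2 l (vop_iter Y YW u v w).

(* The least l satisfying weak associativity.  The default value 0 is not
   reached under truncation and the Jacobi identity, which imply that such an
   l exists. *)
Definition assoc_order (V W : lmodType K) (Y : V -> int -> V -> V)
    (YW : V -> int -> W -> W) (u : V) (w : W) : nat :=
  xget 0%N [set l | weak_assoc_at Y YW u w l /\
                    forall k, weak_assoc_at Y YW u w k -> (l <= k)%N].

End VertexOperators.

(* Main.v *)
Require Import Defs.
From mathcomp Require Import all_boot all_order all_algebra.
From mathcomp Require Import finmap.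
From mathcomp Require Import boolp classical_sets functions cardinality fsbigop.
From mathcomp Require Import reals complex zify ring.

Set Implicit Arguments.
Unset Strict Implicit.
Unset Printing Implicit Defensive.

Import Order.TTheory GRing.Theory Num.Theory.
Local Open Scope classical_set_scope.
Local Open Scope ring_scope.

(** The substitution x_0 |-> - x_2 + x_1 turns (x_0 + x_2) into x_1 whenever
both sides make sense, so it is enough to understand the limit after
multiplication by one large power of x_0 + x_2.  Write
A = Y_W(u, x_1) Y_W(v, x_2) w, B = Y_W(v, x_2) Y_W(u, x_1) w,
C = Y_W(Y(u, x_0) v, x_2) w, and let S and L be the substitutions
x_1 |-> x_0 + x_2 and x_0 |-> - x_2 + x_1.

Choose k such that x_1^k Y_W(u, x_1) w has no negative powers of x_1.  The
coefficients of x_1^(- k - 1) in the Jacobi identity do not see B, and say that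
(x_0 + x_2)^k C = S (x_1^k A) ([mul_pow_iter]); this is weak associativity
with exponent k.  The coefficients of sufficiently negative powers
of x_0 do not see C, and say that (x_1 - x_2)^r A = (x_1 - x_2)^r B
([vop_prod_locality]).  Let H be (x_1 - x_2)^r x_1^k times either of A and B:
it has no negative powers of x_1 and is truncated from below in x_2, and on
such series L undoes S ([minus_plusK]).  Since S turns x_1 - x_2 into x_0 and L
turns x_0 back into x_1 - x_2,
H = L (S H) = L (x_0^r (x_0 + x_2)^k C) = (x_1 - x_2)^r L ((x_0 + x_2)^k C).
Cancelling (x_1 - x_2)^r, which is legitimate among series truncated from below
in x_1, gives L ((x_0 + x_2)^k C) = x_1^k B ([minus_mul_pow_large]).

Now let l be minimal for weak associativity, so that l <= k.  By weak
associativity, F = (x_0 + x_2)^l C equals (x_0 + x_2)^l S A and is therefore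
truncated from below in x_2 as well as in x_0, which makes L F well defined.
Then x_1^(k - l) L F = L ((x_0 + x_2)^(k - l) F) = x_1^k B, that is
L F = x_1^l B ([formal_lim_weak_assoc]). *)

(** * Finitely supported sums *)

Section FiniteSums.
Variables (K : numFieldType) (E : lmodType K).

Lemma fsum_lin (I : choiceType) (a b : K) (F G : I -> E) :
  finite_set [set d | F d != 0] -> finite_set [set d | G d != 0] ->
  \sum_(d \in [set: I]) (a *: F d + b *: G d)
  = a *: \sum_(d \in [set: I]) F d + b *: \sum_(d \in [set: I]) G d.
Proof.
move=> finF finG.
pose X := fset_set ([set d | F d != 0] `|` [set d | G d != 0]).
have inX i : i \notin X -> F i = 0 /\ G i = 0.
  rewrite /X in_fset_set; last by rewrite finite_setU.
  move=> /negP iX; split; apply/eqP; apply: contra_notT iX => Fi; rewrite inE.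
    by left.
  by right.
rewrite !(fsbigTE X) => [|i /inX[]//|i /inX[]//|i /inX[-> ->]]; last first.
  by rewrite !scaler0 addr0.
by rewrite big_split /= !scaler_sumr.
Qed.

Lemma fsum_inj (I J : choiceType) (h : J -> I) (F : I -> E) :
  injective h -> (forall i, F i != 0 -> exists j, i = h j) ->
  \sum_(i \in [set: I]) F i = \sum_(j \in [set: J]) F (h j).
Proof.
move=> hinj Fh; rewrite -(fsbig_image _ h) => [|x y _ _ /hinj //].
apply/esym/fsbig_widen => // i [_ ih] /=; apply/eqP.
by apply: contra_notT ih => /Fh[j ->]; exists j.
Qed.

Lemma finite_support_nat (I : Type) (P : set I) (h : nat -> I) (N : nat) :
  (forall d, P d -> exists2 i, (i < N)%N & d = h i) -> finite_set P.
Proof.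
move=> Ph; apply: (@sub_finite_set _ _ (h @` `I_N)).
  by move=> d /Ph[i iN ->]; exists i.
exact/finite_image/finite_II.
Qed.

End FiniteSums.

(** * Binomial expansions *)

Section Binomials.
Variable K : numFieldType.
Implicit Types (a b : K) (n p q : int).

Lemma binom_coef0 n : binom_coef K n 0 = 1.
Proof. by rewrite /binom_coef big_ord0 fact0 divr1. Qed.

Lemma binom_coef_pascal n (i : nat) :
  binom_coef K (n + 1) i.+1 = binom_coef K n i + binom_coef K n i.+1.
Proof.
have -> : binom_coef K (n + 1) i.+1
    = (n + 1)%:~R * \prod_(j < i) (n%:~R - j%:R) / i.+1`!%:R.
  rewrite /binom_coef big_ord_recl subr0; congr (_ * _ / _).
  apply: eq_bigr => j _.
  by rewrite lift0 -natr1 rmorphD /=; ring.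
rewrite /binom_coef big_ord_recr /=.
have i0 : i`!%:R != 0 :> K by rewrite pnatr_eq0 -lt0n fact_gt0.
have i1 : i.+1%:R != 0 :> K by rewrite pnatr_eq0.
rewrite factS natrM rmorphD /= -natr1 in i1 *.
by field; rewrite i0 i1.
Qed.

Lemma binom_coef0S (i : nat) : binom_coef K 0 i.+1 = 0.
Proof. by rewrite /binom_coef big_ord_recl subr0 mul0r mul0r. Qed.

Lemma binom_exp_eq0 n a b p q : q < 0 -> binom_exp n a b p q = 0.
Proof. by case: q. Qed.

Lemma binom_exp_deg n a b p q : binom_exp n a b p q != 0 -> 0 <= q /\ p + q = n.
Proof.
case: q => [i|i] /=; last by rewrite eqxx.
by case: ifP => [/eqP <- _|_]; [split | rewrite eqxx].
Qed.

Lemma binom_exp0 a b p q : binom_exp 0 a b p q = ((p == 0) && (q == 0))%:R.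
Proof.
case: q => [[|i]|i] /=; last by rewrite andbF.
  rewrite addr0 binom_coef0 andbT expr0 mulr1 mul1r.
  by case: eqP => // ->; rewrite expr0z.
by rewrite binom_coef0S !mul0r if_same andbF.
Qed.

Lemma binom_exp_pascal n a b p q : a != 0 ->
  binom_exp (n + 1) a b p q
  = a * binom_exp n a b (p - 1) q + b * binom_exp n a b p (q - 1).
Proof.
move=> a0; case: q => [[|i]|i]; last first.
- by rewrite !binom_exp_eq0 ?mulr0 ?addr0 //; lia.
- have -> : i.+1%:Z - 1 = i by lia.
  rewrite /binom_exp binom_coef_pascal.
  have -> : (p - 1 + i.+1 == n) = (p + i.+1 == n + 1) by lia.
  have -> : (p + i == n) = (p + i.+1 == n + 1) by lia.
  case: eqP => _; last by rewrite !mulr0 addr0.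
  have -> : a ^ p = a * a ^ (p - 1).
    by rewrite -[p in LHS](subrK 1) expfzDr // mulrC.
  by rewrite exprS; ring.
- rewrite [X in b * X]binom_exp_eq0 // mulr0 addr0 /binom_exp !binom_coef0.
  have -> : (p - 1 + 0 == n) = (p + 0 == n + 1) by lia.
  case: eqP => _; last by rewrite mulr0.
  have -> : a ^ p = a * a ^ (p - 1).
    by rewrite -[p in LHS](subrK 1) expfzDr // mulrC.
  by ring.
Qed.

(** A nonnegative power of a binomial does not depend on the variable in which
it is expanded. *)
Lemma binom_exp_sym (r : nat) a b p q : a != 0 -> b != 0 ->
  binom_exp r a b p q = binom_exp r b a q p.
Proof.
move=> a0 b0; elim: r p q => [|r IH] p q; first by rewrite !binom_exp0 andbC.
by rewrite -addn1 PoszD !binom_exp_pascal // !IH addrC.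
Qed.

Lemma binom_exp_nat (r : nat) a b p q : a != 0 -> b != 0 ->
  binom_exp r a b p q != 0 -> [/\ 0 <= p, 0 <= q & p + q = r].
Proof.
move=> a0 b0 nz; have [? ?] := binom_exp_deg nz.
by move: nz; rewrite binom_exp_sym // => /binom_exp_deg[? _].
Qed.

Lemma binom_expN n p q :
  binom_exp n (- 1 : K) 1 p q = (- 1) ^ n * binom_exp n 1 (- 1) p q.
Proof.
case: q => [i|i] /=; last by rewrite mulr0.
case: eqP => [<-|_]; last by rewrite mulr0.
rewrite expfzDr ?oppr_eq0 ?oner_neq0 // exp1rz expr1n !mulr1.
rewrite -[(- 1) ^ Posz i]/((- 1) ^+ i) [_ * (_ * (- 1) ^+ i)]mulrCA -!mulrA.
by rewrite -expr2 sqrr_sign mulr1.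
Qed.

(** Entrywise, binom(- n - 1, k) (-1)^k = binom(n + k, k).  This is the
delta-function identity x_1^(-1) delta((x_0 + x_2) / x_1)
= x_0^(-1) delta((x_1 - x_2) / x_0). *)
Lemma binom_exp_neg n j k :
  binom_exp (- n - 1) 1 (- 1 : K) j k = binom_exp (- 1 - j) 1 1 n k.
Proof.
case: k => //= k.
have -> : (j + k == - n - 1) = (n + k == - 1 - j) by lia.
case: eqP => // <-; rewrite !exp1rz expr1n !mulr1 /binom_coef mulrAC; congr (_ / _).
rewrite (reindex_inj rev_ord_inj) /= -[X in _ * _ ^+ X](card_ord k).
rewrite -prodr_const -big_split /=.
apply: eq_bigr => i _; rewrite natrB // -natr1 !rmorphD !rmorphN /= pmulrn.
by ring.
Qed.

End Binomials.

(** * Shifts, linear factors and binomial substitutions *)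

Section Substitution.
Variables (K : numFieldType) (E : lmodType K).
Implicit Types (f g : int * int -> E) (M N : int).

(** [shift1], [shift2] and [mul_linear a b] multiply a series in two variables
y and z by y, by z and by a y + b z. *)
Definition shift1 f (e : int * int) : E := f (e.1 - 1, e.2).
Definition shift2 f (e : int * int) : E := f (e.1, e.2 - 1).
Definition mul_linear (a b : K) f (e : int * int) : E :=
  a *: shift1 f e + b *: shift2 f e.

(** Truncation from below: no power of the first (second) variable has an
exponent less than the bound, uniformly in the other exponent. *)
Definition bounded1 N f := forall p q, p < N -> f (p, q) = 0.
Definition bounded2 M f := forall p q, q < M -> f (p, q) = 0.

Lemma bounded1_shift1 N f : bounded1 N f -> bounded1 N (shift1 f).
Proof. by move=> fN p q pN; apply: fN => /=; lia. Qed.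
Lemma bounded1_shift2 N f : bounded1 N f -> bounded1 N (shift2 f).
Proof. by move=> fN p q pN; apply: fN. Qed.
Lemma bounded2_shift1 M f : bounded2 M f -> bounded2 M (shift1 f).
Proof. by move=> fN p q pN; apply: fN. Qed.
Lemma bounded2_shift2 M f : bounded2 M f -> bounded2 M (shift2 f).
Proof. by move=> fN p q pN; apply: fN => /=; lia. Qed.

Lemma bounded1_mul_linear N a b f : bounded1 N f -> bounded1 N (mul_linear a b f).
Proof.
move=> fN p q pN; rewrite /mul_linear (bounded1_shift1 fN) // (bounded1_shift2 fN) //.
by rewrite !scaler0 addr0.
Qed.
Lemma bounded2_mul_linear N a b f : bounded2 N f -> bounded2 N (mul_linear a b f).
Proof.
move=> fN p q pN; rewrite /mul_linear (bounded2_shift1 fN) // (bounded2_shift2 fN) //.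
by rewrite !scaler0 addr0.
Qed.

Lemma iter_preserves (T : Type) (P : T -> Prop) (h : T -> T) (r : nat) x :
  (forall y, P y -> P (h y)) -> P x -> P (iter r h x).
Proof. by move=> hP Px; elim: r => //= r; apply: hP. Qed.

(** If s h = k s on a class of arguments stable under h, then s h^r = k^r s
there. *)
Lemma iter_intertwine (T : Type) (P : T -> Prop) (s h k : T -> T) (r : nat) x :
  (forall y, P y -> P (h y)) -> (forall y, P y -> s (h y) = k (s y)) ->
  P x -> s (iter r h x) = iter r k (s x).
Proof.
by move=> hP shk Px; elim: r => //= r <-; apply: shk; apply: iter_preserves.
Qed.

Lemma iter_shift1 (r : nat) f p q : iter r shift1 f (p, q) = f (p - r%:Z, q).
Proof.
elim: r p => [|r IH] p /=; first by rewrite subr0.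
by rewrite {1}/shift1 /= IH; congr (f (_, _)); lia.
Qed.

Section Kernel.
Variable B : int -> int -> int -> K.

Lemma subst_lin (a b : K) f g : subst_summable B f -> subst_summable B g ->
  subst_series B (fun e => a *: f e + b *: g e)
  = fun e => a *: subst_series B f e + b *: subst_series B g e.
Proof.
move=> sf sg; apply/funext => e; rewrite /subst_series -fsum_lin //.
apply: eq_fsbigr => d _; rewrite /subst_term scalerDr !scalerA.
by rewrite mulrC [b * _]mulrC.
Qed.

Lemma subst_shift2 f : subst_series B (shift2 f) = shift2 (subst_series B f).
Proof.
apply/funext => e; rewrite /subst_series /shift2.
rewrite (@reindex_fsbigT _ _ _ _ _ (fun d : int * int => (d.1, d.2 + 1))); last first.
  by exists (fun d : int * int => (d.1, d.2 - 1)) => -[d1 d2] /=; rewrite ?addrK ?subrK.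
apply: eq_fsbigr => -[d1 d2] _; rewrite /subst_term /= addrK.
by congr (B _ _ _ *: _); lia.
Qed.

(** When the powers replacing y^n satisfy the recursion of (a y + b z)^n,
substituting in y f amounts to multiplying the result by a y + b z. *)
Lemma subst_shift1 (a b : K) f :
  (forall n p q, B (n + 1) p q = a * B n (p - 1) q + b * B n p (q - 1)) ->
  subst_summable B f ->
  subst_series B (shift1 f) = mul_linear a b (subst_series B f).
Proof.
move=> pascal sf; apply/funext => e; rewrite /mul_linear /shift1 /shift2.
rewrite /subst_series -fsum_lin //.
rewrite (@reindex_fsbigT _ _ _ _ _ (fun d : int * int => (d.1 + 1, d.2))); last first.
  by exists (fun d : int * int => (d.1 - 1, d.2)) => -[d1 d2] /=; rewrite ?addrK ?subrK.
apply: eq_fsbigr => -[d1 d2] _; rewrite /subst_term /= addrK pascal scalerDl.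
by rewrite !scalerA addrAC.
Qed.

End Kernel.

(** The exponent of x_2 in f is bounded below by hypothesis, and bounded above
because (x_0 + x_2)^n contributes nonnegative powers of x_2 only. *)
Lemma plus_summable M f : bounded2 M f -> subst_summable (@plus_x0_x2 K) f.
Proof.
move=> fM [p q].
apply: (@finite_support_nat _ _ (fun i : nat => (p + i%:Z, q - i%:Z)) `|q - M|.+1).
move=> [d1 d2] /=; rewrite /subst_term /= => nz.
have /binom_exp_deg[ge0 deg] : binom_exp d1 1 1 p (q - d2) != 0 :> K.
  by apply: contraNneq nz => z; rewrite /plus_x0_x2 z scale0r.
have dM : M <= d2.
  by rewrite leNgt; apply: contraNN nz => /fM ->; rewrite scaler0.
by exists `|q - d2|%N; [lia | congr (_, _); lia].
Qed.

(** The total degree being preserved, both exponents of a contributing term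
of f are bounded on both sides. *)
Lemma minus_summable N M f : bounded1 N f -> bounded2 M f ->
  subst_summable (@minus_x2_plus_x1 K) f.
Proof.
move=> fN fM [p q].
apply: (@finite_support_nat _ _
  (fun i : nat => (N + i%:Z, q + p - N - i%:Z)) `|(q + p - N - M)%R|%N.+1).
move=> [d1 d2] /=; rewrite /subst_term /= => nz.
have /binom_exp_deg[ge0 deg] : binom_exp d1 (-1) 1 (q - d2) p != 0 :> K.
  by apply: contraNneq nz => z; rewrite /minus_x2_plus_x1 z scale0r.
have dM : M <= d2.
  by rewrite leNgt; apply: contraNN nz => /fM ->; rewrite scaler0.
have dN : N <= d1.
  by rewrite leNgt; apply: contraNN nz => /fN ->; rewrite scaler0.
by exists `|d1 - N|%N; [lia | congr (_, _); lia].
Qed.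

Notation S := (subst_series (@plus_x0_x2 K)).
Notation L := (subst_series (@minus_x2_plus_x1 K)).

Lemma oppr1_neq0 : -1 != 0 :> K.
Proof. by rewrite oppr_eq0 oner_eq0. Qed.

Lemma plus_shift1 M f : bounded2 M f -> S (shift1 f) = mul_linear 1 1 (S f).
Proof.
move=> /plus_summable fM; apply: subst_shift1 => // n p q.
by apply: binom_exp_pascal; rewrite oner_eq0.
Qed.

Lemma minus_shift1 N M f : bounded1 N f -> bounded2 M f ->
  L (shift1 f) = mul_linear 1 (-1) (L f).
Proof.
move=> fN fM; apply: subst_shift1; last exact: minus_summable fN fM.
move=> n p q; rewrite /minus_x2_plus_x1 binom_exp_pascal ?oppr1_neq0 //.
by rewrite addrC.
Qed.

(** x_1 - x_2 |-> (x_0 + x_2) - x_2 = x_0. *)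
Lemma plus_mul_sub M f : bounded2 M f ->
  S (mul_linear 1 (-1) f) = shift1 (S f).
Proof.
move=> fM; rewrite (@subst_lin _ _ _ (shift1 f) (shift2 f)); last 2 first.
- exact: plus_summable (bounded2_shift1 fM).
- exact: plus_summable (bounded2_shift2 fM).
apply/funext => e; rewrite (plus_shift1 fM) subst_shift2 /mul_linear.
by rewrite scaleN1r !scale1r addrK.
Qed.

(** x_0 + x_2 |-> (- x_2 + x_1) + x_2 = x_1. *)
Lemma minus_mul_add N M f : bounded1 N f -> bounded2 M f ->
  L (mul_linear 1 1 f) = shift1 (L f).
Proof.
move=> fN fM; rewrite (@subst_lin _ _ _ (shift1 f) (shift2 f)); last 2 first.
- exact: minus_summable (bounded1_shift1 fN) (bounded2_shift1 fM).
- exact: minus_summable (bounded1_shift2 fN) (bounded2_shift2 fM).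
apply/funext => e; rewrite (minus_shift1 fN fM) subst_shift2 /mul_linear.
by rewrite scaleN1r !scale1r subrK.
Qed.

Lemma plus_bounded2 M f : bounded2 M f -> bounded2 M (S f).
Proof.
move=> fM p q qM; rewrite /subst_series fsbig1 // => -[d1 d2] _.
rewrite /subst_term /=; case: (ltP d2 M) => [/fM ->|Md2]; first by rewrite scaler0.
by rewrite /plus_x0_x2 binom_exp_eq0 ?scale0r //; lia.
Qed.

Lemma plus_bounded1 f : bounded1 0 f -> bounded1 0 (S f).
Proof.
move=> f0 p q p0; rewrite /subst_series fsbig1 // => -[d1 d2] _.
rewrite /subst_term /=; case: (ltP d1 0) => [/f0 ->|]; first by rewrite scaler0.
case: d1 => // r _; apply/eqP; rewrite scaler_eq0; apply/orP; left.
apply: contraT => nz.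
have [] := @binom_exp_nat K r 1 1 p (q - d2) (oner_neq0 _) (oner_neq0 _) nz; lia.
Qed.

Lemma minus_bounded1 f : bounded1 0 (L f).
Proof.
move=> p q p0; rewrite /subst_series fsbig1 // => d _.
by rewrite /subst_term /minus_x2_plus_x1 binom_exp_eq0 // scale0r.
Qed.

(** A series of degree 0 in the substituted variable is unchanged. *)
Lemma subst_deg0 (B : int -> int -> int -> K) f :
  (forall p q, B 0 p q = ((p == 0) && (q == 0))%:R) ->
  (forall p q, p != 0 -> f (p, q) = 0) -> subst_series B f = f.
Proof.
move=> B0 f0; apply/funext => -[p q]; rewrite /subst_series.
have -> : f (p, q) = \sum_(d \in [set (0 : int, q)]) subst_term B f (p, q) d.
  rewrite fsbig_set1 /subst_term /= B0 subrr eqxx andbT.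
  by have [->|p0] := eqVneq p 0; rewrite ?scale1r // scale0r f0.
apply/esym/fsbig_widen => // -[d1 d2] [_ /= dq]; rewrite /subst_term /=.
have [d10|d1n] := eqVneq d1 0; last by rewrite f0 // scaler0.
rewrite d10 B0 subr_eq0; case: (q =P d2) => [qd|_]; last by rewrite andbF scale0r.
by case: dq; rewrite d10 qd.
Qed.

(** Substituting x_1 |-> x_0 + x_2 and then x_0 |-> - x_2 + x_1 is the identity
on series without negative powers of x_1.  The proof writes
f = g(x_2) + x_1 h(x_1, x_2), where g is fixed by both substitutions and their
composite commutes with x_1, and inducts on the exponent of x_1. *)
Lemma minus_plusK M f : bounded1 0 f -> bounded2 M f -> L (S f) = f.
Proof.
pose g (f : int * int -> E) (e : int * int) := if e.1 == 0 then f e else 0.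
pose h (f : int * int -> E) (e : int * int) := if 0 <= e.1 then f (e.1 + 1, e.2) else 0.
have h0 f' : bounded1 0 (h f') by move=> a b a0; rewrite /h /= leNgt a0.
have hM f' : bounded2 M f' -> bounded2 M (h f').
  by move=> fM a b bM; rewrite /h /= fM // if_same.
have g0 f' : bounded1 0 (g f').
  by move=> a b a0; rewrite /g /= lt_eqF.
have gM f' : bounded2 M f' -> bounded2 M (g f').
  by move=> fM a b bM; rewrite /g /= fM // if_same.
have gE (B : int -> int -> int -> K) f' :
    (forall p q, B 0 p q = ((p == 0) && (q == 0))%:R) ->
    subst_series B (g f') = g f'.
  by move=> B0; apply: subst_deg0 => // a b a0; rewrite /g /= (negPf a0).
have fE f' : bounded1 0 f' -> f' = fun e => 1 *: g f' e + 1 *: shift1 (h f') e.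
  move=> f0; apply/funext => -[a b].
  rewrite !scale1r /g /shift1 /h /= subrK subr_ge0.
  case: (ltgtP a 0) => a0.
  - by rewrite ifF ?f0 ?addr0 //; lia.
  - by rewrite ifT ?add0r //; lia.
  - by rewrite ifF ?addr0 //; lia.
have step f' : bounded1 0 f' -> bounded2 M f' ->
    L (S f') = fun e => 1 *: g f' e + 1 *: shift1 (L (S (h f'))) e.
  move=> f0 fM; rewrite {1}(fE _ f0).
  rewrite (@subst_lin _ _ _ (g f') (shift1 (h f'))); last 2 first.
  - exact: plus_summable (gM _ fM).
  - exact: plus_summable (bounded2_shift1 (hM _ fM)).
  rewrite gE; last exact: binom_exp0.
  rewrite (plus_shift1 (hM _ fM)).
  have b1 := plus_bounded1 (h0 f').
  have b2 := plus_bounded2 (hM _ fM).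
  rewrite (@subst_lin _ _ _ (g f') (mul_linear 1 1 (S (h f')))); last 2 first.
  - exact: minus_summable (g0 _) (gM _ fM).
  - apply: minus_summable; first exact: bounded1_mul_linear b1.
    exact: bounded2_mul_linear b2.
  rewrite (minus_mul_add b1 b2) gE // => p q.
  by rewrite /minus_x2_plus_x1 binom_exp0 andbC.
move=> f0 fM; apply/funext => -[p q].
case: p => [p|p]; last by rewrite minus_bounded1 // f0.
elim: p f f0 fM q => [|p IH] f f0 fM q; rewrite step // !scale1r /shift1 /g /=.
  by rewrite minus_bounded1 // addr0.
have -> : p.+1%:Z - 1 = p by lia.
rewrite add0r IH; [|exact: h0|exact: hM].
by rewrite /h /=; congr (f (_, _)); lia.
Qed.

Lemma series_mul_binom (r : nat) (a b : K) f : a != 0 -> b != 0 ->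
  series_mul (fun d => binom_exp r a b d.1 d.2) f = iter r (mul_linear a b) f.
Proof.
move=> a0 b0; apply/funext => e; elim: r e => [|r IH] e /=.
  rewrite /series_mul.
  transitivity (\sum_(d \in [set (0 : int, 0 : int)])
                  ((binom_exp 0 a b d.1 d.2 : K) *: f (e - d))).
    apply/esym/fsbig_widen => // -[d1 d2] [_ /= d0]; rewrite binom_exp0.
    case: (d1 =P 0) => [d10|_]; case: (d2 =P 0) => [d20|_]; rewrite ?scale0r //.
    by case: d0; rewrite d10 d20.
  by rewrite fsbig_set1 binom_exp0 !eqxx scale1r subr0.
have fin (u : int * int) : finite_set
    [set d : int * int | binom_exp r a b (d - u).1 (d - u).2 *: f (e - d) != 0].
  apply: (@finite_support_nat _ _ (fun i : nat => (r%:Z - i%:Z + u.1, i%:Z + u.2)) r.+1).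
  move=> [d1 d2] /= nz.
  have {}nz : binom_exp r a b (d1 - u.1) (d2 - u.2) != 0.
    by apply: contraNneq nz => ->; rewrite scale0r.
  have [? ? ?] := binom_exp_nat a0 b0 nz.
  by exists `|d2 - u.2|%N; [lia | congr (_, _); lia].
have sh (u : int * int) : iter r (mul_linear a b) f (e - u)
    = \sum_(d \in [set: int * int])
        ((binom_exp r a b (d - u).1 (d - u).2) *: f (e - d)).
  rewrite -IH /series_mul.
  rewrite (@reindex_fsbigT _ _ _ _ _ (fun d : int * int => d - u)); last first.
    by exists (fun d : int * int => d + u) => d; rewrite ?addrK ?subrK.
  by apply: eq_fsbigr => d _; rewrite opprB addrA subrK.
rewrite /mul_linear /shift1 /shift2.
have -> : (e.1 - 1, e.2) = e - (1, 0).
  by case: (e) => x y; congr (_, _); rewrite /= subr0.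
have -> : (e.1, e.2 - 1) = e - (0, 1).
  by case: (e) => x y; congr (_, _); rewrite /= subr0.
rewrite !sh -fsum_lin; [|exact: fin..].
rewrite /series_mul; apply: eq_fsbigr => -[d1 d2] _.
rewrite !scalerA -scalerDl; congr (_ *: _).
rewrite -addn1 PoszD binom_exp_pascal //.
by congr (_ * binom_exp _ _ _ _ _ + _ * binom_exp _ _ _ _ _); rewrite /= subr0.
Qed.

End Substitution.

Arguments shift1 {K E} f e.
Arguments mul_linear {K E} a b f e.

(** Multiplication by a power of x_1 - x_2 is injective on series truncated from
below in x_1: in each total degree the coefficients of the product determine
those of the factor, starting from the lowest power of x_1. *)
Lemma mul_linear_cancel (K : numFieldType) (E : lmodType K) (N : int)
    (r : nat) (f g : int * int -> E) :
  bounded1 N f -> bounded1 N g ->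
  iter r (mul_linear 1 (-1)) f = iter r (mul_linear 1 (-1)) g -> f = g.
Proof.
have one (f' g' : int * int -> E) : bounded1 N f' -> bounded1 N g' ->
    mul_linear 1 (-1) f' = mul_linear 1 (-1) g' -> f' = g'.
  move=> fN gN fg.
  have rec n q : f' (N - 1 + n%:Z, q) = g' (N - 1 + n%:Z, q).
    elim: n q => [|n IH] q; first by rewrite fN ?gN //; lia.
    have /(congr1 (fun h => h (N - 1 + n.+1%:Z, q + 1))) := fg.
    rewrite /mul_linear /shift1 /shift2 /= addrK !scale1r !scaleN1r.
    have -> : N - 1 + n.+1%:Z - 1 = N - 1 + n%:Z by lia.
    by rewrite IH => /addrI/oppr_inj.
  apply/funext => -[p q]; case: (ltP p N) => pN; first by rewrite fN ?gN.
  have := rec `|(p - N + 1)%R|%N q.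
  by have -> : N - 1 + `|(p - N + 1)%R|%N%:Z = p by lia.
elim: r f g => //= r IH f g fN gN /one fg; apply: IH => //; apply: fg.
  exact: (iter_preserves (P := bounded1 N)) (@bounded1_mul_linear _ _ N 1 (-1)) fN.
exact: (iter_preserves (P := bounded1 N)) (@bounded1_mul_linear _ _ N 1 (-1)) gN.
Qed.

(** * The Jacobi identity in two-variable form *)

Section JacobiSlices.
Variables (K : numFieldType) (E : lmodType K).
Implicit Types (F : int * int * int -> K) (g : int * int -> E).

Lemma pairB (S T : zmodType) (a c : S) (b d : T) : (a, b) - (c, d) = (a - c, b - d).
Proof. by []. Qed.

(** Multiplying a series in three variables by one that does not involve the
first (second) of them only uses one slice of the former. *)
Lemma series_mul_slice1 F g e0 e1 e2 :
  series_mul F (fun '(i, j, k) => if i == 0 then g (j, k) else 0) (e0, e1, e2)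
  = series_mul (fun d => F (e0, d.1, d.2)) g (e1, e2).
Proof.
rewrite /series_mul (@fsum_inj _ _ _ _ (fun d : int * int => (e0, d.1, d.2))).
- by apply: eq_fsbigr => -[d1 d2] _; rewrite !pairB subrr eqxx.
- by move=> [a b] [c d] [-> ->].
- move=> [[i j] k]; rewrite !pairB subr_eq0; case: ifP => [/eqP <- _|_].
    by exists (j, k).
  by rewrite scaler0 eqxx.
Qed.

Lemma series_mul_slice2 F g e0 e1 e2 :
  series_mul F (fun '(i, j, k) => if j == 0 then g (i, k) else 0) (e0, e1, e2)
  = series_mul (fun d => F (d.1, e1, d.2)) g (e0, e2).
Proof.
rewrite /series_mul (@fsum_inj _ _ _ _ (fun d : int * int => (d.1, e1, d.2))).
- by apply: eq_fsbigr => -[d1 d2] _; rewrite !pairB subrr eqxx.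
- by move=> [a b] [c d] [-> ->].
- move=> [[i j] k]; rewrite !pairB subr_eq0; case: ifP => [/eqP <- _|_].
    by exists (i, k).
  by rewrite scaler0 eqxx.
Qed.

Lemma eq_series_mul (a b : int * int -> K) g : a =1 b -> series_mul a g = series_mul b g.
Proof. by move=> /funext ->. Qed.

End JacobiSlices.

Section JacobiModes.
Variables (K : numFieldType) (V W : lmodType K).
Variables (Y : V -> int -> V -> V) (YW : V -> int -> W -> W).
Hypotheses (hlin : bilinear_modes YW) (htrunc : truncation YW).
Hypothesis (hjac : jacobi Y YW).
Implicit Types (u v : V) (w : W).

Notation S := (subst_series (@plus_x0_x2 K)).
Notation X1 := shift1.

(** The product in the opposite order, Y_W(v, x_2) Y_W(u, x_1) w, still indexed
by the exponents of x_1 and x_2 in this order. *)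
Definition vop_prod_op v u w (e : int * int) : W := vop_prod YW v u w (e.2, e.1).

Lemma vop0l w p : vop YW 0 w p = 0.
Proof.
by rewrite /vop -[in LHS](subrr (0 : V)) -scaleN1r addrC hlin.2 scaleN1r addNr.
Qed.

Lemma vop0r v p : vop YW v 0 p = 0.
Proof.
have := hlin.1 v (- p - 1) (-1) 0 0.
by rewrite scaler0 addr0 scaleN1r addNr.
Qed.

(** Coefficient of x_0^e0 x_1^e1 x_2^e2 in the Jacobi identity.  On each side one
variable occurs in the delta functions only, which leaves sums over
the exponents of x_1 and x_2 on the left and of x_0 and x_2 on the right. *)
Lemma jacobi_coef u v w e0 e1 e2 :
  series_mul (fun d => binom_exp (- e0 - 1) 1 (-1) d.1 d.2)
    (vop_prod YW u v w) (e1, e2)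
  - series_mul (fun d => (-1) ^ (e0 + 1) * binom_exp (- e0 - 1) 1 (-1) d.2 d.1)
    (vop_prod_op v u w) (e1, e2)
  = series_mul (fun d => binom_exp (- d.2 - 1) 1 (-1) e1 d.1)
    (vop_iter Y YW u v w) (e0, e2).
Proof.
have := hjac u v w (e0, e1, e2).
rewrite series_mul_slice1 (series_mul_slice1 _ (vop_prod_op v u w)).
rewrite series_mul_slice2 /delta_binom !opprD.
under eq_series_mul => d do rewrite exp1rz mul1r.
move=> ->; apply: (congr1 (fun f => f _)); apply: eq_series_mul => d.
by rewrite exp1rz mul1r opprD.
Qed.

(** Coefficient of x_1^(- m - 1) in the Jacobi identity: only the powers x_1^j
with j < - m of Y_W(u, x_1) w enter the middle term, and they vanish. *)
Lemma mul_pow_iter u v w (m : nat) :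
  (forall n, m%:Z <= n -> YW u n w = 0) ->
  mul_pow_x0_x2 m (vop_iter Y YW u v w) = S (iter m X1 (vop_prod YW u v w)).
Proof.
move=> um; apply/funext => -[p q].
have := jacobi_coef u v w p (- m%:Z - 1) q.
have -> : series_mul (fun d => (-1) ^ (p + 1) * binom_exp (- p - 1) 1 (-1) d.2 d.1)
    (vop_prod_op v u w) (- m%:Z - 1, q) = 0.
  rewrite /series_mul fsbig1 // => -[i j] _.
  rewrite /vop_prod_op pairB /vop_prod /=.
  have [i0|i0] := ltP i 0; first by rewrite binom_exp_eq0 // mulr0 scale0r.
  rewrite [vop YW u w _]um; last by lia.
  by rewrite vop0r scaler0.
rewrite subr0.
have -> : series_mul (fun d => binom_exp (- d.2 - 1) 1 (-1) (- m%:Z - 1) d.1)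
    (vop_iter Y YW u v w) (p, q) = mul_pow_x0_x2 m (vop_iter Y YW u v w) (p, q).
  apply: (congr1 (fun f => f _)); apply: eq_series_mul => d.
  rewrite binom_exp_neg binom_exp_sym ?oner_neq0 //.
  by congr (binom_exp _ _ _ _ _); lia.
move=> <-; rewrite /series_mul /subst_series.
rewrite (@reindex_fsbigT _ _ _ _ _ (fun d : int * int => (- 1 - d.1, q - d.2))); last first.
  by exists (fun d : int * int => (- 1 - d.1, q - d.2)) => -[a b] /=; rewrite !subKr.
apply: eq_fsbigr => -[a b] _; rewrite /subst_term /plus_x0_x2 iter_shift1 pairB /=.
rewrite binom_exp_neg !subKr.
by have -> : - m%:Z - 1 - (- 1 - a) = a - m%:Z by lia.
Qed.

Lemma vop_bounded u w : exists N : int, forall p, p < N -> vop YW u w p = 0.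
Proof.
by have [N uN] := htrunc u w; exists (- N) => p pN; apply: uN; lia.
Qed.

Lemma vop_prod_bounded2 u v w : exists M : int, bounded2 M (vop_prod YW u v w).
Proof.
have [M vM] := vop_bounded v w.
by exists M => p q qM; rewrite /vop_prod /= vM // vop0r.
Qed.

Lemma weak_assoc_large u w (m : nat) :
  (forall n, m%:Z <= n -> YW u n w = 0) -> weak_assoc_at Y YW u w m.
Proof.
move=> um v; have [M vM] := vop_prod_bounded2 u v w.
rewrite (mul_pow_iter v um) /mul_pow_x0_x2 series_mul_binom ?oner_neq0 //.
apply/esym; apply: (iter_intertwine (P := bounded2 M)) => //.
  exact: bounded2_shift1.
exact: plus_shift1.
Qed.

End JacobiModes.

(** * Locality and the formal limit *)

Section FormalLimit.
Variables (K : numFieldType) (V W : lmodType K).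
Variables (Y : V -> int -> V -> V) (YW : V -> int -> W -> W).
Hypotheses (htruncV : truncation Y).
Hypotheses (hlin : bilinear_modes YW) (htrunc : truncation YW).
Hypothesis (hjac : jacobi Y YW).
Implicit Types (u v : V) (w : W).

Notation S := (subst_series (@plus_x0_x2 K)).
Notation L := (subst_series (@minus_x2_plus_x1 K)).
Notation X1 := shift1.
Notation mulD := (mul_linear 1 1).
Notation mulB := (mul_linear 1 (-1)).

Lemma vop_iter_bounded1 u v w : exists N : int, bounded1 N (vop_iter Y YW u v w).
Proof.
have [N uN] := vop_bounded htruncV u v.
by exists N => p q pN; rewrite /vop_iter /= uN // vop0l.
Qed.

(** (x_1 - x_2)^r kills the commutator of Y_W(u, x_1) and Y_W(v, x_2) once
x_0^r Y(u, x_0) v has no negative powers of x_0. *)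
Lemma vop_prod_locality u v : exists r : nat, forall w,
  iter r mulB (vop_prod YW u v w) = iter r mulB (vop_prod_op YW v u w).
Proof.
have [N uN] := htruncV u v; exists `|N|%N => w; set r := `|N|%N.
apply/funext => -[p q].
have := jacobi_coef hjac u v w (- r%:Z - 1) p q.
rewrite [RHS]fsbig1; last first.
  move=> [i k] _; rewrite pairB /vop_iter /=.
  have [i0|i0] := ltP i 0; first by rewrite binom_exp_eq0 // scale0r.
  rewrite [vop Y u v _]uN; last by lia.
  by rewrite vop0l // scaler0.
move/eqP; rewrite subr_eq0 => /eqP.
have -> : - (- r%:Z - 1) - 1 = r by lia.
rewrite series_mul_binom ?oner_neq0 ?oppr1_neq0 // => ->.
rewrite -series_mul_binom ?oner_neq0 ?oppr1_neq0 //.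
apply: (congr1 (fun f => f _)); apply: eq_series_mul => d.
rewrite subrK [in LHS]binom_exp_sym ?oner_neq0 ?oppr1_neq0 // binom_expN mulrA.
by rewrite -expfzDr ?oppr1_neq0 // addNr mul1r.
Qed.

(** The limit formula for every exponent k that clears the poles of
Y_W(u, x_1) w. *)
Lemma minus_mul_pow_large u v w (k : nat) :
  (forall n, k%:Z <= n -> YW u n w = 0) ->
  L (mul_pow_x0_x2 k (vop_iter Y YW u v w))
  = iter k X1 (vop_prod_op YW v u w).
Proof.
move=> uk; rewrite (mul_pow_iter hlin hjac v uk).
set A := vop_prod YW u v w; set B := vop_prod_op YW v u w.
have [r locr] := vop_prod_locality u v.
have [M AM] := vop_prod_bounded2 hlin htrunc u v w.
have B0 : bounded1 0 (iter k X1 B).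
  move=> p q p0; rewrite iter_shift1 /B /vop_prod_op /vop_prod /=.
  by rewrite [vop YW u w _]uk ?vop0r //; lia.
have AkM : bounded2 M (iter k X1 A).
  by apply: (iter_preserves (P := bounded2 M)) AM => f; apply: bounded2_shift1.
have comm (f : int * int -> W) :
    iter k X1 (iter r mulB f) = iter r mulB (iter k X1 f).
  apply: (iter_intertwine (P := fun=> True)) => // g _.
  by apply/esym; apply: (iter_intertwine (P := fun=> True)).
(* Both sides are the series that L S fixes: the bound in x_1 comes from B, the
   bound in x_2 from A. *)
have ABk : iter r mulB (iter k X1 A) = iter r mulB (iter k X1 B).
  by rewrite -!comm locr.
set F := S (iter k X1 A).
have FM : bounded2 M F by exact: plus_bounded2.
have HM : bounded2 M (iter r mulB (iter k X1 A)).
  by apply: (iter_preserves (P := bounded2 M)) AkM => f; apply: bounded2_mul_linear.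
have H0 : bounded1 0 (iter r mulB (iter k X1 A)).
  rewrite ABk; apply: (iter_preserves (P := bounded1 0)) B0 => f.
  exact: bounded1_mul_linear.
have [N CN] := vop_iter_bounded1 u v w.
have FN : bounded1 N F.
  rewrite /F -(mul_pow_iter hlin hjac v uk) /mul_pow_x0_x2.
  rewrite series_mul_binom ?oner_neq0 //.
  by apply: (iter_preserves (P := bounded1 N)) CN => f; apply: bounded1_mul_linear.
apply: (mul_linear_cancel (N := 0) (r := r)) => //; first exact: minus_bounded1.
rewrite -ABk -[RHS](minus_plusK H0 HM).
rewrite (iter_intertwine (P := bounded2 M) (s := S) (k := X1)) //; last 2 first.
- exact: bounded2_mul_linear.
- exact: plus_mul_sub.
rewrite (iter_intertwine (P := fun f => bounded1 N f /\ bounded2 M f)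
  (s := L) (h := X1) (k := mulB)) //.
- move=> f [fN fM]; split; [exact: bounded1_shift1 | exact: bounded2_shift1].
- by move=> f [fN fM]; apply: minus_shift1 fN fM.
Qed.

Lemma assoc_orderP u w (k : nat) : weak_assoc_at Y YW u w k ->
  weak_assoc_at Y YW u w (assoc_order Y YW u w)
  /\ (assoc_order Y YW u w <= k)%N.
Proof.
move=> wk; rewrite /assoc_order; set P := [set l | _].
suff [wl lmin] : P (xget 0%N P) by split => //; apply: lmin.
apply: xgetPex.
have ex : exists m, `[< weak_assoc_at Y YW u w m >] by exists k; apply/asboolP.
exists (ex_minn ex); case: ex_minnP => m /asboolP wm mmin; split => // n /asboolP.
exact: mmin.
Qed.

(** Descent from a large exponent k to any exponent l for which weak
associativity holds. *)
Lemma formal_lim_weak_assoc u v w (l : nat) : weak_assoc_at Y YW u w l ->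
  (exists2 k : nat, (l <= k)%N & forall n, k%:Z <= n -> YW u n w = 0) ->
  has_formal_lim (mul_pow_x0_x2 l (vop_iter Y YW u v w))
    (iter l X1 (vop_prod_op YW v u w)).
Proof.
move=> wl [k lk uk].
have [N CN] := vop_iter_bounded1 u v w.
have [M AM] := vop_prod_bounded2 hlin htrunc u v w.
set C := vop_iter Y YW u v w; set F := mul_pow_x0_x2 l C.
have powE m (f : int * int -> W) : mul_pow_x0_x2 m f = iter m mulD f.
  by rewrite /mul_pow_x0_x2 series_mul_binom ?oner_neq0.
have FN : bounded1 N F.
  rewrite /F powE.
  by apply: (iter_preserves (P := bounded1 N)) CN => f; apply: bounded1_mul_linear.
have FM : bounded2 M F.
  rewrite /F -wl powE.
  apply: (iter_preserves (P := bounded2 M)); last exact: plus_bounded2.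
  by move=> f; apply: bounded2_mul_linear.
split; first exact: minus_summable FN FM.
(* L ((x_0 + x_2)^(k - l) F) = x_1^(k - l) L F, to be compared with x_1^k B. *)
have := minus_mul_pow_large v uk.
rewrite -(subnK lk) powE iterD -(powE l) -/C -/F.
rewrite (iter_intertwine (P := fun f => bounded1 N f /\ bounded2 M f)
  (s := L) (k := X1)) //; last 2 first.
- by move=> f [fN fM]; split; [exact: bounded1_mul_linear | exact: bounded2_mul_linear].
- by move=> f [fN fM]; apply: minus_mul_add fN fM.
rewrite iterD => eqk; apply/funext => -[p q].
have /(congr1 (fun f => f (p + (k - l)%N%:Z, q))) := eqk.
by rewrite !(iter_shift1 (k - l)) addrK.
Qed.

End FormalLimit.

Theorem theorem3p4 (R : realType) (V : lmodType R[i])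
    (gr : int -> set V) (Y : V -> int -> V -> V) (vac om : V)
    (hV : is_voa gr Y vac om)
    (W : lmodType R[i]) (YW : V -> int -> W -> W)
    (hlin : bilinear_modes YW)
    (htrunc : truncation YW)
    (hjacobi : jacobi Y YW)
    (u v : V) (w : W) :
  let l := assoc_order Y YW u w in
  has_formal_lim
    (mul_pow_x0_x2 l (vop_iter Y YW u v w))
    (fun '(a, b) => vop YW v (vop YW u w (a - l%:Z)) b).
Proof.
move=> l; have [N uN] := htrunc u w.
have uk n : `|N|%N%:Z <= n -> YW u n w = 0 by move=> Nn; apply: uN; lia.
have wk : weak_assoc_at Y YW u w `|N|%N by exact: weak_assoc_large uk.
have [wl lk] := assoc_orderP wk.
have -> : (fun '(a, b) => vop YW v (vop YW u w (a - l%:Z)) b)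
    = iter l shift1 (vop_prod_op YW v u w).
  by apply/funext => -[a b]; rewrite iter_shift1.
apply: formal_lim_weak_assoc => //; first exact: voa_truncation hV.
by exists `|N|%N.
Qed.
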